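(* Let $n,L\ge 1$ be integers, and let $\phi:A_n^L\to\mathcal{S}_L$ be the map sending each word of length $L$ over $A_n=\{1,\dots,n\}$ to its permutation type (so the domain of $\phi$ is $A_n^L$ and $\phi^{-1}(\pi)\subseteq A_n^L$). Let $\mu:\mathcal{S}_L\to\mathbb{N}^L$ be the map defined in the context. (i) For $\pi\in\mathcal{S}_L$, if $\phi^{-1}(\pi)\neq\emptyset$, then $|\phi^{-1}(\pi)|=\binom{L+n-i}{n-i}$ for some $1\le i\le n$. (ii) For $\pi\in\mathcal{S}_L$, the following two statements are equivalent: (a) $|\phi^{-1}(\pi)|=1$; (b) $\pi$ appears for the first time at $n$. (iii) For $s_1^L\in A_n^L$, the following three statements are equivalent: (c) $\phi^{-1}(\pi)=\{s_1^L\}$ for some $\pi\in\mathcal{S}_L$; (d) for any $1\le i\le n-1$ there exist $1\le j<k\le L$ such that $s_j=i+1$ and $s_k=i$; (e) $s_1^L\notin A_{n-1}^L$ and $s_1^L=\mu\circ\phi(s_1^L)$. (iv) If $\phi$ is restricted to the subset of $A_n^L$ consisting of the words satisfying one of the three equivalent conditions (c), (d), (e), then $\phi$ gives a one-to-one correspondence between these words and the permutations in $\mathcal{S}_L$ satisfying one of the two equivalent conditions (a), (b), with inverse $\mu$.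
   Context: For an integer $m\ge 1$, $A_m=\{1,2,\dots,m\}$ with its usual total order; $A_0=\emptyset$; $\mathbb{N}=\{1,2,3,\dots\}$. A word of length $L\ge 1$ over an alphabet $A$ is an element $s_1^L=s_1\cdots s_L\in A^L$. $\mathcal{S}_L$ is the set of all permutations (bijections) of $\{1,\dots,L\}$. Permutation type: a word $s_1^L$ over $\mathbb{N}$ is of type $\pi\in\mathcal{S}_L$ if for every $i=1,\dots,L-1$ we have $s_{\pi(i)}\le s_{\pi(i+1)}$, and $\pi(i)<\pi(i+1)$ whenever $s_{\pi(i)}=s_{\pi(i+1)}$. Each word has a unique type, denoted $\phi(s_1^L)$. For $i\ge1$, a permutation $\pi\in\mathcal{S}_L$ appears for the first time at $i$ if there is no word in $A_{i-1}^L$ of type $\pi$ but there is a word in $A_i^L$ of type $\pi$. The map $\mu:\mathcal{S}_L\to\mathbb{N}^L$: a maximal ascending sequence in a sequence is a block of consecutive terms that is ascending and cannot be extended by the adjacent term on the left or on the right while remaining ascending. Decompose $\pi(1)\cdots\pi(L)$ into its maximal ascending sequences $\pi(1)\cdots\pi(i_1),\ \pi(i_1+1)\cdots\pi(i_2),\ \dots,\ \pi(i_{k-1}+1)\cdots\pi(L)$. Then $\mu(\pi)=s_1^L$ is the word with $s_{\pi(1)}=\cdots=s_{\pi(i_1)}=1$, $s_{\pi(i_1+1)}=\cdots=s_{\pi(i_2)}=2$, $\dots$, $s_{\pi(i_{k-1}+1)}=\cdots=s_{\pi(L)}=k$. *)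

(* Defs.v *)
From mathcomp Require Import all_boot all_fingroup.

Set Implicit Arguments.
Unset Strict Implicit.
Unset Printing Implicit Defensive.

(* MathComp world.
   Positions 1, ..., L are encoded by 'I_L = {0, ..., L-1}, so that S_L is 'S_L
   (shifting all positions by one changes none of the notions below).
   Letters are NOT shifted: [nword L] holds their actual values, and the
   alphabet A_n = {1, ..., n} is indexed by 'I_n, a : 'I_n standing for a.+1. *)

Definition nword (L : nat) := {ffun 'I_L -> nat}.

Definition word (n L : nat) := {ffun 'I_L -> 'I_n}.

Definition letters (n L : nat) (s : word n L) : nword L := [ffun j => (s j).+1].

Definition has_type (L : nat) (w : nword L) (p : 'S_L) : bool :=
  [forall i : 'I_L, forall j : 'I_L, (j == i.+1 :> nat) ==>
     (w (p i) <= w (p j)) && ((w (p i) == w (p j)) ==> (p i < p j))].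

Section TypeOfWord.
Variables (L : nat) (w : nword L).

Definition word_lt : rel 'I_L :=
  fun a b => (w a < w b) || ((w a == w b) && (a < b)).

Lemma word_lt_trans : transitive word_lt.
Proof.
move=> b a c /orP[ab|/andP[/eqP ab ab']] /orP[bc|/andP[/eqP bc bc']];
  apply/orP.
- by left; apply: ltn_trans bc.
- by left; rewrite -bc.
- by left; rewrite ab.
- by right; rewrite ab bc eqxx (ltn_trans ab' bc').
Qed.

Lemma word_lt_irr : irreflexive word_lt.
Proof. by move=> a; rewrite /word_lt !ltnn andbF. Qed.

Lemma word_lt_total (a b : 'I_L) : a != b -> word_lt a b || word_lt b a.
Proof.
rewrite /word_lt -(inj_eq val_inj) neq_ltn => ab.
by case: (ltngtP (w a) (w b)).
Qed.

Lemma has_typeE (p : 'S_L) :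
  has_type w p = sorted word_lt [seq p i | i <- enum 'I_L].
Proof.
have step (i j : 'I_L) :
    (w (p i) <= w (p j)) && ((w (p i) == w (p j)) ==> (p i < p j))
    = word_lt (p i) (p j).
  by rewrite /word_lt; case: (ltngtP (w (p i)) (w (p j))).
have sz : size [seq p i | i <- enum 'I_L] = L by rewrite size_map size_enum_ord.
have nthp (i : 'I_L) (a : 'I_L) : nth a [seq p i | i <- enum 'I_L] i = p i.
  by rewrite (nth_map a) ?size_enum_ord ?ltn_ord // nth_ord_enum.
apply/idP/idP.
- move=> /forallP H.
  case: (posnP L) => [L0|Lgt0].
    by have -> : [seq p i | i <- enum 'I_L] = [::] by apply/nilP; rewrite /nilp sz L0.
  apply/(sortedP (Ordinal Lgt0)) => i; rewrite sz => iL.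
  have /forallP/(_ (Ordinal iL)) := H (Ordinal (ltnW iL)).
  rewrite eqxx implyTb step.
  by rewrite -(nthp (Ordinal iL) (Ordinal Lgt0))
             -(nthp (Ordinal (ltnW iL)) (Ordinal Lgt0)).
- move=> /(sortedP _) H; apply/forallP => i; apply/forallP => j.
  apply/implyP => /eqP ji; rewrite step.
  have := H i i; rewrite sz -ji ltn_ord => /(_ isT).
  by rewrite !nthp.
Qed.

Lemma has_type_exists : exists p : 'S_L, has_type w p.
Proof.
pose r := fun a b : 'I_L => (a == b) || word_lt a b.
have rtot : total r.
  move=> a b; rewrite /r; case: (eqVneq a b) => [->|ab]; first by rewrite ?eqxx.
  by rewrite orFb orbCA word_lt_total ?orbT.
have rtr : transitive r.
  move=> b a c /orP[/eqP->//|ab] /orP[/eqP<-|bc]; apply/orP; right=> //.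
  exact: word_lt_trans bc.
pose t := sort r (enum 'I_L).
have szt : size t == L by rewrite size_sort size_enum_ord.
have tu : uniq t by rewrite sort_uniq enum_uniq.
have finj : injective (tnth (Tuple szt)).
  by move=> i j; apply: tuple_uniqP.
exists (perm finj); rewrite has_typeE.
have -> : [seq perm finj i | i <- enum 'I_L] = t.
  rewrite -[RHS]/(tval (Tuple szt)) -[in RHS](map_tnth_enum (Tuple szt)).
  by apply: eq_map => i; rewrite permE.
have : sorted r t by apply: sort_sorted.
rewrite !sorted_pairwise //; last exact: word_lt_trans.
elim: t tu {szt finj} => //= a t IH /andP[at' tu] /andP[ra rt].
rewrite IH // andbT; apply/allP => b bt.
have /orP[/eqP ab|//] := allP ra b bt.
by rewrite ab bt in at'.
Qed.

Lemma has_type_unique (p q : 'S_L) : has_type w p -> has_type w q -> p = q.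
Proof.
rewrite !has_typeE => sp sq.
have E : [seq p i | i <- enum 'I_L] = [seq q i | i <- enum 'I_L].
  apply: (irr_sorted_eq word_lt_trans word_lt_irr sp sq) => a.
  transitivity true; [|symmetry]; apply/mapP.
  - by exists ((p^-1)%g a); rewrite ?mem_enum ?permKV.
  - by exists ((q^-1)%g a); rewrite ?mem_enum ?permKV.
by apply/permP => i; move/eq_in_map: E => -> //; rewrite mem_enum.
Qed.

Definition phi : 'S_L := xchoose has_type_exists.

Lemma phiP : has_type w phi.
Proof. exact: xchooseP. Qed.

Lemma phi_eq (p : 'S_L) : (phi == p) = has_type w p.
Proof.
by apply/eqP/idP => [<-|wp]; [exact: phiP | exact: has_type_unique phiP wp].
Qed.

End TypeOfWord.

Definition phiA (n L : nat) (s : word n L) : 'S_L := phi (letters s).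

Definition fibre (n L : nat) (p : 'S_L) : {set word n L} :=
  @phiA n L @^-1: [set p].

Definition appears_first_at (L : nat) (p : 'S_L) (i : nat) : Prop :=
  ~ (exists s : word (i - 1) L, has_type (letters s) p) /\
  (exists s : word i L, has_type (letters s) p).

Section Mu.
Variables (L : nat) (p : 'S_L).

Definition ascending (a b : 'I_L) : bool :=
  (a <= b) &&
  [forall i : 'I_L, forall j : 'I_L,
     [&& a <= i, i < j & j <= b] ==> (p i < p j)].

Definition max_ascending (a b : 'I_L) : bool :=
  [&& ascending a b,
      [forall a' : 'I_L, (a'.+1 == a) ==> ~~ ascending a' b]
    & [forall b' : 'I_L, (b' == b.+1 :> nat) ==> ~~ ascending a b']].

(* The maximal ascending sequences p(a) ... p(b) partition the positions, so
   the one containing position i is the k-th from the left, where k is the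
   number of them starting at or before i. *)
Definition run_index (i : 'I_L) : nat :=
  #|[set ab : 'I_L * 'I_L | max_ascending ab.1 ab.2 & ab.1 <= i]|.

Definition mu : nword L := [ffun j => run_index ((p^-1)%g j)].

End Mu.

Section Conditions.
Variables (n L : nat).

Definition cond_a (p : 'S_L) : Prop := #|fibre n p| = 1.

Definition cond_b (p : 'S_L) : Prop := appears_first_at p n.

Definition cond_c (s : word n L) : Prop :=
  exists p : 'S_L, fibre n p = [set s].

Definition cond_d (s : word n L) : Prop :=
  forall i : nat, 1 <= i <= n - 1 ->
    exists j k : 'I_L, [/\ j < k, letters s j = i.+1 & letters s k = i].

Definition cond_e (s : word n L) : Prop :=
  ~ (exists t : word (n - 1) L, letters t = letters s) /\
  letters s = mu (phiA s).

End Conditions.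

(* Main.v *)
Require Import Defs.
From mathcomp Require Import all_boot all_fingroup.
From mathcomp Require Import zify.

Set Implicit Arguments.
Unset Strict Implicit.
Unset Printing Implicit Defensive.

(* Let r(i) = run_index p i, which is 1 plus the number of descents of p before
   position i.  A word w has type p iff i |-> w (p i) - r(i) is nondecreasing.
   If p has k ascending runs, the words over {1, ..., n} of type p therefore
   correspond to the nondecreasing sequences of length L in {0, ..., n - k}; the
   zero sequence is mu p.  So the fibre has 'C(L + n - k, n - k) elements when
   k <= n and is empty otherwise, and (a)-(e) all say that k = n. *)

(** Types and run indices are controlled only at adjacent positions; chaining the steps gives the
    comparison of arbitrary positions. *)
Lemma ord_le_ind L (r : rel 'I_L) :
  reflexive r -> transitive r -> (forall i j : 'I_L, j = i.+1 :> nat -> r i j) ->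
  forall i j : 'I_L, i <= j -> r i j.
Proof.
move=> rr rt rS i [j jL] /= ij.
elim: j jL ij => [|j IH] jL ij.
  by have -> : i = Ordinal jL by apply: val_inj => /=; lia.
case: (ltngtP i j.+1) ij => // [ij _|ij _]; last first.
  by have -> : i = Ordinal jL by apply: val_inj.
by apply: rt (IH (ltnW jL) _) _; [lia|apply: rS].
Qed.

Lemma perm_ord_neq L (p : 'S_L) (i j : 'I_L) : i <> j :> nat -> p i <> p j :> nat.
Proof. by move=> ij /val_inj/perm_inj e; apply: ij; rewrite e. Qed.

(** A local test for the left end of a run, vacuously true at position 0. Counting left ends
    replaces counting pairs of ends. *)
Definition run_start L (p : 'S_L) (a : 'I_L) : bool :=
  [forall i : 'I_L, (i.+1 == a) ==> (p a < p i)].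

(** * Maximal ascending runs, run indices and permutation types *)

Section Runs.
Variables (L : nat) (p : 'S_L).

Lemma ascendingP (a b : 'I_L) :
  reflect (a <= b /\ forall i j : 'I_L, a <= i -> i < j -> j <= b -> p i < p j)
          (ascending p a b).
Proof.
apply: (iffP andP) => -[ab H]; split=> //.
  move=> i j ai ij jb; have /forallP/(_ i)/forallP/(_ j) := H.
  by rewrite ai ij jb.
apply/forallP => i; apply/forallP => j; apply/implyP => /and3P[].
exact: H.
Qed.

(** Without a descent just before [a], the block could be extended to the left. *)
Lemma max_ascending_start (a b : 'I_L) : max_ascending p a b -> run_start p a.
Proof.
case/and3P=> /ascendingP[ab H] /forallP Hl _.
apply/forallP => i; apply/implyP => ia.
have := implyP (Hl i) ia; apply: contraNT; rewrite -leqNgt => pia.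
have ia' := eqP ia.
have pia' : p i < p a by have := @perm_ord_neq _ p i a; lia.
apply/ascendingP; split; first by lia.
move=> x y ix xy yb; case: (ltngtP i x) ix => // [ix|/val_inj ex] _.
  by apply: H => //; lia.
subst x; case: (ltngtP a y) => [ay|ya|/val_inj <- //]; last by lia.
by apply: (ltn_trans pia'); apply: H.
Qed.

(** The shorter of two such blocks could be extended by one term inside the longer one. *)
Lemma max_ascending_inj (a b b' : 'I_L) :
  max_ascending p a b -> max_ascending p a b' -> b = b'.
Proof.
wlog bb' : b b' / b <= b' => [IH|] Hb Hb'.
  by case: (leqP b b') => [|/ltnW] le; [|symmetry]; apply: IH.
case/and3P: Hb => /ascendingP[ab _] _ /forallP Hr.
case/and3P: Hb' => /ascendingP[ab' H] _ _.
apply/val_inj/eqP; rewrite eqn_leq bb' /= leqNgt; apply/negP => lt.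
have cL : b.+1 < L by apply: leq_ltn_trans lt (ltn_ord _).
have /implyP/(_ (eqxx _))/negP := Hr (Ordinal cL); apply.
apply/ascendingP; split=> [/=|i j ai ij /= jb]; first by lia.
by apply: H => //; lia.
Qed.

Lemma run_start_max_ascending (a : 'I_L) :
  run_start p a -> exists b, max_ascending p a b.
Proof.
move=> /forallP Ha.
have aa : ascending p a a by apply/ascendingP; split=> // i j; lia.
case: (arg_maxnP (fun b : 'I_L => b : nat) aa) => b Hb bmax.
exists b; rewrite /max_ascending Hb /=; apply/andP; split; apply/forallP => c;
  apply/implyP => /eqP ec; apply/negP.
  move=> /ascendingP[cb H]; have := implyP (Ha c); rewrite ec eqxx => /(_ isT).
  have /ascendingP[ab _] := Hb.
  by have := H c a; lia.
by move=> /bmax /=; rewrite ec ltnn.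
Qed.

Lemma run_indexE (i : 'I_L) :
  run_index p i = #|[set a : 'I_L | run_start p a & a <= i]|.
Proof.
rewrite /run_index; set S := [set _ | _ & _].
have <- : [set ab.1 | ab in S] = [set a : 'I_L | run_start p a & a <= i].
  apply/setP => a; rewrite inE; apply/imsetP/andP.
    by case=> -[x y]; rewrite inE /= => /andP[/max_ascending_start sx xi] ->.
  case=> /run_start_max_ascending[b ab] ai.
  by exists (a, b); rewrite ?inE ?ab.
rewrite card_in_imset // => -[x y] [x' y']; rewrite !inE /=.
move=> /andP[mx _] /andP[mx' _] exx'; subst x'.
by rewrite (max_ascending_inj mx mx').
Qed.

(** Passing from [i] to [j] can add only [j] itself to the run starts counted, and it does so
    exactly at a descent. *)
Lemma run_indexS (i j : 'I_L) : j = i.+1 :> nat ->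
  run_index p j = run_index p i + (p j < p i).
Proof.
move=> ji; rewrite !run_indexE.
have startj : run_start p j = (p j < p i).
  apply/forallP/idP => [/(_ i)|pji x]; first by rewrite ji eqxx.
  apply/implyP; rewrite ji eqSS => /eqP /val_inj -> //.
case: (boolP (p j < p i)) => pji; last first.
  rewrite addn0; apply: eq_card => a; rewrite !inE.
  case: (boolP (run_start p a)) => //= sa.
  case: (eqVneq a j) => [ea|]; first by rewrite -startj -ea sa in pji.
  by rewrite -(inj_eq val_inj) /= => /eqP ne; apply/idP/idP; lia.
rewrite addn1 -[RHS]add1n.
have -> : [set a : 'I_L | run_start p a & a <= j] =
          j |: [set a : 'I_L | run_start p a & a <= i].
  apply/setP => a; rewrite !inE; case: (eqVneq a j) => [->|] /=.
    by rewrite startj pji leqnn.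
  rewrite -(inj_eq val_inj) /= => /eqP ne; congr (_ && _).
  by apply/idP/idP; lia.
by rewrite cardsU1 inE ji ltnn andbF.
Qed.

Lemma leq_run_index (i j : 'I_L) : i <= j -> run_index p i <= run_index p j.
Proof.
apply: (@ord_le_ind _ (fun i j => run_index p i <= run_index p j)) => //.
- by move=> y x z; apply: leq_trans.
- by move=> x y /run_indexS ->; apply: leq_addr.
Qed.

Lemma ltn_run_index (i j : 'I_L) : i <= j -> p j < p i ->
  run_index p i < run_index p j.
Proof.
move=> ij pji.
(* The lexicographic order on (run index, value): each adjacent step either ascends or raises the
   run index, so positions increase in it. *)
pose r (x y : 'I_L) := (run_index p x < run_index p y) ||
  (run_index p x == run_index p y) && (p x <= p y).
suff : r i j by rewrite /r; lia.
apply: ord_le_ind ij; rewrite /r.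
- by move=> x; rewrite eqxx leqnn orbT.
- by move=> y x z; lia.
- by move=> x y /run_indexS ->; case: ltnP => /=; lia.
Qed.

(** At an ascent of [p] the type condition is a weak increase of letters; at a descent the increase
    must be strict, which is the unit gained by the run index. Adding on both sides avoids truncated
    subtraction. *)
Lemma has_typeP (w : nword L) :
  reflect (forall i j : 'I_L, i <= j ->
             w (p i) + run_index p j <= w (p j) + run_index p i)
          (has_type w p).
Proof.
have stepE (i j : 'I_L) : j = i.+1 :> nat ->
    (w (p i) <= w (p j)) && ((w (p i) == w (p j)) ==> (p i < p j)) =
    (w (p i) + run_index p j <= w (p j) + run_index p i).
  move=> ji; rewrite (run_indexS ji).
  have := @perm_ord_neq _ p i j.
  by case: (ltngtP (p i) (p j)); lia.
apply: (iffP idP) => [/forallP H|H].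
- apply: ord_le_ind => [x|y x z|i j ji]; [by []|by lia|].
  by rewrite -stepE //; have /forallP/(_ j) := H i; rewrite ji eqxx.
- apply/forallP => i; apply/forallP => j; apply/implyP => /eqP ji.
  by rewrite stepE //; apply: H; lia.
Qed.

Lemma mu_perm (i : 'I_L) : mu p (p i) = run_index p i.
Proof. by rewrite ffunE permK. Qed.

Lemma mu_has_type : has_type (mu p) p.
Proof. by apply/has_typeP => i j _; rewrite !mu_perm addnC. Qed.

End Runs.

(** * Counting the words of a given type *)

Definition nruns L (p : 'S_L.+1) : nat := run_index p ord_max.

Section Fibres.
Variables (L : nat) (p : 'S_L.+1).

Lemma run_index0 : run_index p ord0 = 1.
Proof.
rewrite run_indexE; apply/eqP/cards1P; exists ord0; apply/setP => a.
rewrite !inE leqn0 -(inj_eq val_inj) /= andbC.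
case: eqP => //= a0; apply/forallP => i.
by rewrite a0.
Qed.

Lemma run_index_gt0 i : 0 < run_index p i.
Proof. by rewrite -run_index0 leq_run_index. Qed.

Lemma run_index_le_nruns i : run_index p i <= nruns p.
Proof. by apply: leq_run_index; rewrite leq_ord. Qed.

Lemma in_fibre n (s : word n L.+1) : (s \in fibre n p) = has_type (letters s) p.
Proof. by rewrite !inE phi_eq. Qed.

(** At position 0 the run index is 1 and the letter at least 1; their difference can only grow
    afterwards. *)
Lemma run_index_le_letter n (s : word n L.+1) i :
  has_type (letters s) p -> run_index p i <= letters s (p i).
Proof.
move=> /has_typeP /(_ ord0 i (leq0n _)); rewrite run_index0 !ffunE; lia.
Qed.

Lemma nruns_le n (s : word n L.+1) : has_type (letters s) p -> nruns p <= n.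
Proof.
move/(run_index_le_letter ord_max) => /leq_trans; apply.
by rewrite ffunE; apply: ltn_ord.
Qed.

Lemma letters_inj n : injective (@letters n L.+1).
Proof.
move=> s t st; apply/ffunP => j; apply/val_inj.
by have /ffunP/(_ j) := st; rewrite !ffunE => -[].
Qed.

(* Adds the run indices to a sequence read along p; since letters s = s + 1
   while run indices start at 1, one unit is taken off. *)
Definition word_of_tuple m n (t : L.+1.-tuple 'I_m.+1) : word n.+1 L.+1 :=
  [ffun j => inord (tnth t (p^-1%g j) + (run_index p (p^-1%g j)).-1)].

Lemma letters_word_of_tuple n (t : L.+1.-tuple 'I_(n.+1 - nruns p).+1) i :
  nruns p <= n.+1 ->
  letters (word_of_tuple n t) (p i) = tnth t i + run_index p i.
Proof.
move=> kn; rewrite !ffunE permK inordK.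
  by have := run_index_gt0 i; lia.
(* Range check for [inord]: the entry is at most [n.+1 - nruns p] and the run index at most
   [nruns p]. *)
have := ltn_ord (tnth t i); have := run_index_le_nruns i.
by have := run_index_gt0 i; lia.
Qed.

Lemma sorted_tupleP m (t : L.+1.-tuple 'I_m.+1) :
  reflect (forall i j : 'I_L.+1, i <= j -> tnth t i <= tnth t j)
          (sorted leq [seq val x | x <- t]).
Proof.
have nthE (i : 'I_L.+1) : nth 0 [seq val x | x <- t] i = tnth t i.
  by rewrite (nth_map ord0) ?size_tuple // -tnth_nth.
apply: (iffP idP) => [H i j ij|H].
  rewrite -!nthE.
  apply: (sorted_leq_nth leq_trans leqnn 0 H) => //.
    by rewrite inE size_map size_tuple.
  by rewrite inE size_map size_tuple.
apply/(sortedP 0) => i; rewrite size_map size_tuple => iL.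
by have := H (Ordinal (ltnW iL)) (Ordinal iL) (leqnSn i); rewrite -!nthE.
Qed.

Lemma fibre_imset n : nruns p <= n.+1 ->
  fibre n.+1 p = [set word_of_tuple n t |
    t in [set t : L.+1.-tuple 'I_(n.+1 - nruns p).+1 |
            sorted leq [seq val x | x <- t]]].
Proof.
move=> kn; apply/setP => s; rewrite in_fibre; apply/idP/imsetP; last first.
  case=> t; rewrite inE => /sorted_tupleP tS ->; apply/has_typeP => i j ij.
  by rewrite !letters_word_of_tuple //; have := tS _ _ ij; lia.
move=> sp; have le := fun i => run_index_le_letter i sp.
move/has_typeP: sp => sp.
pose t := [tuple (inord (letters s (p i) - run_index p i) : 'I_(n.+1 - nruns p).+1)
           | i < L.+1].
(* The difference is largest at the last position, where the letter is at most [n.+1] and the run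
   index is [nruns p]; hence [inord] loses nothing. *)
have tE i : tnth t i = letters s (p i) - run_index p i :> nat.
  rewrite tnth_mktuple inordK //; have := sp i ord_max (leq_ord _).
  rewrite -/(nruns p); have := le i.
  have : letters s (p ord_max) <= n.+1 by rewrite ffunE ltn_ord.
  by lia.
exists t.
  rewrite inE; apply/sorted_tupleP => i j ij; rewrite !tE.
  by have := sp _ _ ij; lia.
apply: letters_inj; apply/ffunP => j; rewrite -[j](permKV p).
by rewrite letters_word_of_tuple // tE subnK.
Qed.

Lemma card_fibre n : nruns p <= n.+1 ->
  #|fibre n.+1 p| = 'C(L.+1 + n.+1 - nruns p, n.+1 - nruns p).
Proof.
move=> kn; rewrite fibre_imset // card_in_imset.
  (* The count of nondecreasing tuples has the tuple length as lower index; the symmetry of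
     binomials matches it with the claim. *)
  rewrite card_sorted_tuples addnBA // -[in RHS]bin_sub; last by lia.
  by congr 'C(_, _); lia.
move=> t u _ _ tu; apply/eq_from_tnth => i; apply/val_inj.
have /(congr1 (fun s => letters s (p i))) := tu.
by rewrite /= !letters_word_of_tuple // => /addIn.
Qed.

Lemma has_type_exP n :
  (exists s : word n L.+1, has_type (letters s) p) <-> nruns p <= n.
Proof.
split=> [[s]|]; first exact: nruns_le.
case: n => [|n kn]; first by have := run_index_gt0 ord_max; rewrite /nruns; lia.
have : 0 < #|fibre n.+1 p| by rewrite card_fibre // bin_gt0; lia.
by case/card_gt0P => s; rewrite in_fibre; exists s.
Qed.

Lemma cond_a_nruns n : cond_a n.+1 p <-> nruns p = n.+1.
Proof.
split=> [H|H]; last by rewrite /cond_a card_fibre H ?subnn ?bin0.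
have [s] : exists s, s \in fibre n.+1 p by apply/card_gt0P; rewrite H.
rewrite in_fibre => /nruns_le kn; move: H; rewrite /cond_a card_fibre // => H.
apply/eqP; rewrite eqn_leq kn leqNgt; apply/negP => lt.
have [m em] : exists m, n.+1 - nruns p = m.+1 by exists (n - nruns p); lia.
(* Pascal's rule splits the count into two positive terms, so it is at least 2. *)
move: H; rewrite -addnBA // em addSn binS addnS.
have : 0 < 'C(L + m.+1, m.+1) by rewrite bin_gt0; lia.
have : 0 < 'C(L + m.+1, m) by rewrite bin_gt0; lia.
rewrite addnS; lia.
Qed.

Lemma cond_b_nruns n : cond_b n.+1 p <-> nruns p = n.+1.
Proof.
rewrite /cond_b /appears_first_at !has_type_exP subn1 /=.
by split=> [[/negP]|->]; [|split=> [/negP|]]; lia.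
Qed.

(** The letters of [mu p] run from 1 to [nruns p], so it is a word over this alphabet, and the fibre
    has only one element. *)
Lemma mu_fibre n : nruns p = n.+1 ->
  exists2 s : word n.+1 L.+1, fibre n.+1 p = [set s] & letters s = mu p.
Proof.
move=> k.
have bound i : (run_index p i).-1 < n.+1.
  by have := run_index_le_nruns i; have := run_index_gt0 i; lia.
pose s : word n.+1 L.+1 := [ffun j => Ordinal (bound (p^-1%g j))].
have sE : letters s = mu p.
  by apply/ffunP => j; rewrite !ffunE /= prednK // run_index_gt0.
exists s => //; have /eqP/cards1P[u fu] := (cond_a_nruns n).2 k.
have : s \in fibre n.+1 p by rewrite in_fibre sE mu_has_type.
by rewrite fu inE => /eqP ->.
Qed.

End Fibres.

(** * Conditions (c), (d), (e) in terms of the number of runs *)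

Section Words.
Variables (n L : nat) (s : word n.+1 L.+1).
Let p := phiA s.

Lemma phiA_type : has_type (letters s) p.
Proof. exact: phiP. Qed.

Lemma letters_mu : nruns p = n.+1 -> letters s = mu p.
Proof.
move/mu_fibre => [u fu <-]; congr letters.
have : s \in fibre n.+1 p by rewrite in_fibre phiA_type.
by rewrite fu inE => /eqP.
Qed.

Lemma cond_c_nruns : cond_c s <-> nruns p = n.+1.
Proof.
split=> [[q fq]|k].
  have : s \in fibre n.+1 q by rewrite fq inE.
  rewrite !inE => /eqP eq; rewrite /p eq; apply/cond_a_nruns.
  by rewrite /cond_a fq cards1.
exists p; have [u fu us] := mu_fibre k.
by rewrite fu; congr [set _]; apply: letters_inj; rewrite us letters_mu.
Qed.

Lemma cond_e_nruns : cond_e s <-> nruns p = n.+1.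
Proof.
split=> [[H sE]|k]; last first.
  split; last exact: letters_mu.
  (* In [mu p], position [p ord_max] carries the letter [n.+1], which a word over [n] letters
     lacks. *)
  rewrite subn1 => -[t /ffunP /(_ (p ord_max))].
  rewrite (letters_mu k) mu_perm -/(nruns p) k ffunE.
  by have := ltn_ord (t (p ord_max)); lia.
apply/eqP; rewrite eqn_leq (nruns_le phiA_type) ltnNge; apply/negP => kn.
apply: H; rewrite subn1 /=.
have bound j : s j < n.
  have : letters s j = (s j).+1 by rewrite ffunE.
  rewrite sE ffunE => e; rewrite /= -e.
  exact: leq_trans (run_index_le_nruns _ _) kn.
by exists [ffun j => Ordinal (bound j)]; apply/ffunP => j; rewrite !ffunE.
Qed.

Lemma nruns_cond_d : nruns p = n.+1 -> cond_d s.
Proof.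
move=> k i; rewrite subn1 /= => /andP[i0 iN].
have [a0 Ha0] : exists a : 'I_L.+1, i < run_index p a.
  by exists ord_max; rewrite -/(nruns p) k.
(* [a] opens run [i.+1]; the descent from [a.-1] to [a] supplies the pair required by (d). *)
case: (@arg_minnP _ a0 (fun a => i < run_index p a) val Ha0) => a Ha amin.
have a_gt0 : 0 < a.
  rewrite lt0n; apply/eqP => a0'.
  have e : a = ord0 by apply: val_inj.
  by move: Ha; rewrite e run_index0; lia.
have bL : a.-1 < L.+1 by have := ltn_ord a; lia.
pose b := Ordinal bL.
have ab : a = b.+1 :> nat by rewrite /= prednK.
have Hb : run_index p b <= i.
  by rewrite leqNgt; apply/negP => /amin /=; rewrite ab ltnn.
have := run_indexS p ab; case: ltnP => /= pab e; last by lia.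
exists (p a), (p b); rewrite (letters_mu k) !mu_perm.
by split; lia.
Qed.

(* The letter minus the run index is nonnegative and nondecreasing along p; each
   pair in (d) forces a descent between letters i and i.+1, so that the run index
   keeps up with the letter. *)
Lemma cond_d_letter_le : cond_d s ->
  forall i x, letters s (p x) = i -> i <= run_index p x.
Proof.
move=> d; have /has_typeP st := phiA_type.
elim=> // -[_|i IH] x xi; first exact: run_index_gt0.
have iN : 1 <= i.+1 <= n.+1 - 1.
  by move: xi; rewrite ffunE; have := ltn_ord (s (p x)); lia.
have [j [k [jk sj sk]]] := d _ iN.
move: jk sj sk; rewrite -[j](permKV p) -[k](permKV p).
move: (p^-1%g j) (p^-1%g k) => y z pyz sy sz.
have zy : z <= y.
  rewrite leqNgt; apply/negP => yz.
  by have := st _ _ (ltnW yz); have := leq_run_index p (ltnW yz); lia.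
have rz := IH _ sz; have ryz := ltn_run_index zy pyz.
(* [x] and [y] carry the same letter, so even if [x] comes first its run index is no smaller than
   that of [y]. *)
case: (leqP y x) => [/(leq_run_index p)|xy]; first by lia.
by have := st _ _ (ltnW xy); lia.
Qed.

Lemma cond_d_nruns : cond_d s <-> nruns p = n.+1.
Proof.
split; last exact: nruns_cond_d.
move=> d; apply/eqP; rewrite eqn_leq (nruns_le phiA_type).
(* The top letter occurs: by (d) for [i = n], or trivially over a one-letter alphabet. Its run index
   is then at least [n.+1]. *)
have [j sj] : exists j, letters s j = n.+1.
  case: (posnP n) => [n0|n0].
    by exists ord0; rewrite ffunE; have := ltn_ord (s ord0); lia.
  have [|j [k [_ sj _]]] := d n; first by lia.
  by exists j.
move: sj; rewrite -[j](permKV p) => /(cond_d_letter_le d) /leq_trans; apply.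
exact: run_index_le_nruns.
Qed.

End Words.

Theorem theorem9 (n L : nat) (hn : 1 <= n) (hL : 1 <= L) :
  (forall p : 'S_L, fibre n p <> set0 ->
     exists i : nat, 1 <= i <= n /\ #|fibre n p| = 'C(L + n - i, n - i))
  /\
  (forall p : 'S_L, cond_a n p <-> cond_b n p)
  /\
  (forall s : word n L,
     (cond_c s <-> cond_d s) /\ (cond_d s <-> cond_e s))
  /\
  (let W := fun s : word n L => cond_c s \/ cond_d s \/ cond_e s in
   let P := fun p : 'S_L => cond_a n p \/ cond_b n p in
   [/\ forall s, W s -> P (phiA s),
       forall p, P p -> exists! s, W s /\ phiA s = p,
       forall s, W s -> mu (phiA s) = letters s
     & forall p, P p ->
         exists s, [/\ W s, letters s = mu p & phiA s = p]]).
Proof.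
case: n hn => // n _; case: L hL => // L _; split=> [p|].
  move=> /eqP/set0Pn[s]; rewrite in_fibre => /nruns_le kn.
  by exists (nruns p); rewrite run_index_gt0 kn card_fibre.
split=> [p|]; first by rewrite cond_a_nruns cond_b_nruns.
split=> [s|W P]; first by rewrite cond_c_nruns cond_d_nruns cond_e_nruns.
have WE s : W s <-> nruns (phiA s) = n.+1.
  by rewrite /W cond_c_nruns cond_d_nruns cond_e_nruns; tauto.
have PE p : P p <-> nruns p = n.+1.
  by rewrite /P cond_a_nruns cond_b_nruns; tauto.
(* The singleton fibre gives uniqueness, and its element [mu p] gives the inverse. *)
have inv p : P p -> exists2 s, fibre n.+1 p = [set s] &
    [/\ W s, letters s = mu p & phiA s = p].
  move/PE => k; have [s fs sp] := mu_fibre k; exists s => //.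
  have : s \in fibre n.+1 p by rewrite fs inE.
  by rewrite !inE => /eqP ep; split=> //; apply/WE; rewrite ep.
split=> [s /WE/PE // | p Pp | s /WE/letters_mu // | p /inv[s _ Hs]].
- have [s fs [Ws _ sp]] := inv p Pp; exists s; split=> // t [_ tp].
  have : t \in fibre n.+1 p by rewrite !inE tp.
  by rewrite fs inE => /eqP.
- by exists s.
Qed.
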